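(* Let $F$ be a field of characteristic two and let $(A,\sigma)$ be a totally decomposable central simple $F$-algebra with orthogonal involution. Then $(A,\sigma)$ has a unique inseparable subalgebra if and only if either $\deg_F A\leqslant 4$ or $\sigma$ is anisotropic.
   Context: An involution $\sigma$ on a central simple $F$-algebra $A$ is an antiautomorphism of order two; here involutions are of the first kind ($\sigma|_F=\mathrm{id}$). $(A,\sigma)$ is totally decomposable if it is isomorphic (as algebra with involution) to a tensor product $\bigotimes_{i=1}^n (Q_i,\sigma_i)$ of quaternion $F$-algebras with involution. $\mathrm{Sym}(A,\sigma)=\{x\in A\mid \sigma(x)=x\}$ and $\mathrm{Sym}(A,\sigma)^+=\{x\in \mathrm{Sym}(A,\sigma)\mid x^2\in F\}$. If $\deg_FA=2^n$, an inseparable subalgebra of $(A,\sigma)$ is a $2^n$-dimensional $F$-subalgebra $S\subseteq \mathrm{Sym}(A,\sigma)^+$ such that $C_A(S)=S$ (the centralizer of $S$ in $A$ equals $S$) and $S$ is generated as an $F$-algebra by $n$ elements. The involution $\sigma$ is isotropic if $\sigma(x)x=0$ for some nonzero $x\in A$, and anisotropic otherwise. *)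

(* Defs.v *)
From HB Require Import structures.
From mathcomp Require Import all_boot all_order all_algebra all_field.
Set Implicit Arguments. Unset Strict Implicit. Unset Printing Implicit Defensive.
Import GRing.Theory.
Local Open Scope ring_scope.

Section CSA.
Variables (F : fieldType) (A : falgType F).

Definition is_subalg (U : {vspace A}) : Prop :=
  1 \in U /\ (U * U <= U)%VS.

Definition is_ideal_of (U I : {vspace A}) : Prop :=
  (I <= U)%VS /\ forall a x, a \in U -> x \in I -> a * x \in I /\ x * a \in I.

Definition central_simple_subalg (U : {vspace A}) : Prop :=
  [/\ is_subalg U, 'Z(U)%VS = 1%VS, U != 0%VS &
      (forall I, is_ideal_of U I -> I = 0%VS \/ I = U)].

Definition central_simple : Prop := central_simple_subalg fullv.

Definition involution (s : A -> A) : Prop :=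
  [/\ (forall (c : F) x y, s (c *: x + y) = c *: s x + s y),
      (forall x y, s (x * y) = s y * s x) &
      forall x, s (s x) = x].

(* In characteristic 2: sigma is symplectic iff 1 is in Symd(A,sigma)
   = {x + sigma x}; orthogonal means not symplectic. *)
Definition orthogonal_char2 (s : A -> A) : Prop :=
  involution s /\ ~ (exists x, x + s x = 1).

Definition quaternion_subalg (Q : {vspace A}) : Prop :=
  central_simple_subalg Q /\ \dim Q = 4%N.

(* (A, sigma) is (internally) a tensor product of sigma-stable quaternion
   subalgebras Q_1, ..., Q_n which pairwise commute and fill A. *)
Definition totally_decomposable (s : A -> A) : Prop :=
  exists (n : nat) (Q : 'I_n -> {vspace A}),
    [/\ forall i, quaternion_subalg (Q i),
        (forall i x, x \in Q i -> s x \in Q i),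
        (forall i j x y, i != j -> x \in Q i -> y \in Q j -> x * y = y * x) &
        \dim (fullv : {vspace A}) = (4 ^ n)%N].

Definition Sym_plus (s : A -> A) (x : A) : Prop :=
  s x = x /\ x * x \in (1%VS : {vspace A}).

Definition inseparable_subalg (s : A -> A) (S : {vspace A}) : Prop :=
  exists n : nat,
    [/\ \dim (fullv : {vspace A}) = (4 ^ n)%N,
        is_subalg S /\ \dim S = (2 ^ n)%N,
        (forall x, x \in S -> Sym_plus s x),
        'C(S)%VS = S &
        (exists xs : seq A, size xs = n /\ agenv (span xs) = S)].

Definition isotropic (s : A -> A) : Prop := exists x : A, x != 0 /\ s x * x = 0.
Definition anisotropic (s : A -> A) : Prop := ~ isotropic s.

End CSA.

(* Main.v *)
(* Each quaternion factor has symmetric generators u, v with uv + vu = v,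
   u^2 + u in F and v^2 in F^*, and S, the centralizer of all the v_i, is an
   inseparable subalgebra.  Conjugating by v_i shows that if S has no nonzero
   element of square zero, then x s(x) in F + Alt forces x in S; hence s is
   anisotropic and Sym^+ = S, so S is unique.
   Any inseparable T lies in F + Alt: A acts, Frobenius-semilinearly in the
   scalars, on the 2^n-dimensional space Sym/Alt by a.[y] = [a y s(a)], and
   the joint kernel of the operators a.[y] + a^2 [y], for a among the n
   generators of T, is the line spanned by [1].  For n <= 2 the elements of Alt
   with square in F all lie in S, so T = S.
   For n >= 3, if x in S is nonzero with x^2 = 0, a conjugate of S by an
   isometry of the form 1 + x (u_j u_l u_i) x is a second inseparable
   subalgebra. *)
Require Import Defs.
From HB Require Import structures.
From mathcomp Require Import all_boot all_order all_algebra all_field zify.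
Set Implicit Arguments. Unset Strict Implicit. Unset Printing Implicit Defensive.
Import GRing.Theory.
Local Open Scope ring_scope.

(** * Dimension estimates from chains of kernels *)

Section LinearAlgebra.
Variables (F : fieldType) (V : vectType F).
Implicit Types (B W : {vspace V}) (f : 'End(V)).

Lemma mem_bigcapv (I : finType) (P : pred I) (U : I -> {vspace V}) x :
  reflect (forall i, P i -> x \in U i) (x \in \bigcap_(i | P i) U i)%VS.
Proof. by rewrite memvE; apply: (iffP subv_bigcapP) => h i Pi; have := h i Pi. Qed.

(** The endomorphism [p] stands in for the projection of [V] onto [V/B]. *)
Lemma ker_quotient B : exists p : 'End(V), lker p = B.
Proof.
exists (\1 - projv B)%VF; apply/vspaceP => x.
rewrite memv_ker add_lfunE opp_lfunE id_lfunE subr_eq0.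
apply/eqP/idP => [->|xB]; first exact: memv_proj.
by rewrite projv_id.
Qed.

(* Rank-nullity for the map induced by [f] on [W/B]. *)
Lemma dim_ker_step B W W0 f :
    (B <= W0)%VS ->
    (forall x, reflect (x \in W /\ f x \in B) (x \in W0)) ->
    (forall y, y \in W0 -> exists2 x, x \in W & f x - y \in B) ->
  (2 * (\dim W0 - \dim B) <= \dim W - \dim B)%N.
Proof.
move=> BW0 W0P imf; have [p kerp] := ker_quotient B.
have pB x : (p x == 0) = (x \in B) by rewrite -memv_ker kerp.
have W0E : W0 = (W :&: lker (p \o f))%VS.
  apply/vspaceP => x; rewrite memv_cap memv_ker comp_lfunE pB.
  by apply/W0P/andP.
have pW0 : (p @: W0 <= (p \o f) @: W)%VS.
  apply/subvP => _ /memv_imgP [y yW0 ->]; have [x xW fxy] := imf y yW0.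
  apply/memv_imgP; exists x => //; apply/esym/eqP.
  by rewrite comp_lfunE -subr_eq0 -linearB /= pB.
have d1 := limg_ker_dim p W0; have d2 := limg_ker_dim (p \o f)%VF W.
move: d1; rewrite kerp (capv_idPr BW0) => d1.
move: d2; rewrite -W0E => d2.
have := dimvS pW0; rewrite -d2 -d1 addKn => le.
by rewrite -addnA addKn mul2n -addnn leq_add2l.
Qed.

(** Modulo [B], the kernel of [f i] on [W i.+1] is [W i] and its image contains [W i], so the
    dimension over [B] at least doubles at each step. *)
Lemma dim_ker_chain n B (W : nat -> {vspace V}) (f : 'I_n -> 'End(V)) :
    (forall k, B <= W k)%VS ->
    (forall (i : 'I_n) x, reflect (x \in W i.+1 /\ f i x \in B) (x \in W i)) ->
    (forall (i : 'I_n) y, y \in W i ->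
       exists2 x, x \in W i.+1 & f i x - y \in B) ->
  (2 ^ n * (\dim (W 0) - \dim B) <= \dim (W n) - \dim B)%N.
Proof.
move=> BW Wker Wim.
suff : forall k, (k <= n)%N ->
    (2 ^ k * (\dim (W 0) - \dim B) <= \dim (W k) - \dim B)%N by apply.
elim=> [|k IH] kn; first by rewrite mul1n.
have := dim_ker_step (BW k) (Wker (Ordinal kn)) (Wim (Ordinal kn)) => /=.
by apply: leq_trans; rewrite expnS -mulnA leq_mul2l IH // ltnW.
Qed.

(** The opposite estimate: [f] maps [W] into its own kernel, which therefore has at least half the
    dimension. If it has exactly half, kernel and image coincide. *)
Lemma dim_ker_le W W0 f :
    (forall x, reflect (x \in W /\ f x = 0) (x \in W0)) ->
    (forall x, x \in W -> f x \in W0) ->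
  (\dim W <= 2 * \dim W0)%N /\
  ((2 * \dim W0 <= \dim W)%N -> (W0 <= f @: W)%VS).
Proof.
move=> W0P imf.
have W0E : W0 = (W :&: lker f)%VS.
  by apply/vspaceP => x; rewrite memv_cap memv_ker; apply/W0P/andP => -[-> /eqP].
have sub : (f @: W <= W0)%VS by apply/subvP => _ /memv_imgP [x xW ->]; exact: imf.
have := limg_ker_dim f W; rewrite -W0E => d.
have le := dimvS sub.
split; first by rewrite -d mul2n -addnn leq_add2l.
rewrite -d mul2n -addnn leq_add2l => ge.
by rewrite -(geq_leqif (dimv_leqif_sup sub)).
Qed.
End LinearAlgebra.

(** * Cancellation in characteristic two *)

Section AddCharTwo.
Variables (F : fieldType) (A : falgType F).
Hypothesis charF : (2 \in [pchar F])%N.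
Implicit Types (x y z : A) (c : F) (Q U W : {vspace A}).

Lemma addvv_char2 x : x + x = 0.
Proof. by rewrite -mulr2n -scaler_nat (pcharf0 charF) scale0r. Qed.

Lemma addKv_char2 x y : x + (x + y) = y.
Proof. by rewrite addrA addvv_char2 add0r. Qed.

Lemma addv_eq0_char2 x y : x + y = 0 -> x = y.
Proof. by move=> xy; rewrite -[LHS]addr0 -(addvv_char2 y) addrA xy add0r. Qed.

End AddCharTwo.

(* [nc2] proves an equality between sums of noncommutative monomials by
   expanding both sides and cancelling equal monomials in pairs. *)
Ltac expand2 := rewrite ?(mulrDl, mulrDr, scalerDr, scalerDl) -?(scalerAl, scalerAr)
  ?(mulrA, mulr1, mul1r, scaler0, mul0r, mulr0).
Ltac cancel2 charF :=
  apply: (addv_eq0_char2 charF);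
  rewrite -[LHS]addr0 -?addrA;
  repeat (match goal with |- _ ?x _ = _ =>
    first [rewrite (addKv_char2 charF x) | rewrite (addrCA _ x)] end);
  rewrite ?addr0 ?add0r; by [].
Ltac nc2 charF := expand2; cancel2 charF.

(** * Inner derivations and centralizers of commuting families *)

Section CharTwo.
Variables (F : fieldType) (A : falgType F).
Hypothesis charF : (2 \in [pchar F])%N.
Implicit Types (x y z : A) (c : F) (Q U W : {vspace A}).

Let addvv_char2 := @addvv_char2 F A charF.
Let addv_eq0_char2 := @addv_eq0_char2 F A charF.

Lemma mem1vP x : reflect (exists c, x = c%:A) (x \in 1%VS).
Proof. exact: vlineP. Qed.

Lemma scalar_unit c x : c != 0 -> x * x = c%:A -> x \is a GRing.unit.
Proof.
move=> c0 xx; apply/unitrP; exists (c^-1 *: x).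
by rewrite -scalerAl -scalerAr xx scalerA mulVf // scale1r.
Qed.

(** Signs are immaterial in characteristic two, so this is the inner derivation of [x]. *)
Definition ad x : 'End(A) := amull x + amulr x.

Lemma adE x y : ad x y = x * y + y * x.
Proof. by rewrite add_lfunE !lfunE. Qed.

Lemma ad_comm x y : x * y = y * x -> ad x y = 0.
Proof. by move=> xy; rewrite adE xy addvv_char2. Qed.

Lemma ad_eq0 x y : ad x y = 0 -> y * x = x * y.
Proof. by rewrite adE => /addv_eq0_char2. Qed.

Lemma cent_ad x y z : x * z = z * x -> y * z = z * y ->
  ad x y * z = z * ad x y.
Proof.
move=> /cent1vP xz /cent1vP yz; apply/cent1vP.
by rewrite adE rpredD ?(memvM (A := 'C[z]%AS)).
Qed.

Lemma ad_derivation x y z : ad x (y * z) = ad x y * z + y * ad x z.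
Proof. rewrite !adE; nc2 charF. Qed.

(* In characteristic two, [ad x] squares to [ad (x * x)]. *)
Lemma ad_idem_sqr x y : x * x \in 1%VS -> ad x (ad x y) = 0.
Proof.
move=> /mem1vP [c xx]; rewrite !adE !mulrDr !mulrDl !mulrA xx -(mulrA y) xx.
rewrite -scalerAl -scalerAr mul1r mulr1; cancel2 charF.
Qed.

Lemma agenv_min (X : seq A) U :
    1 \in U -> (forall x y, x \in U -> y \in U -> x * y \in U) ->
  {subset X <= U} -> (agenv <<X>> <= U)%VS.
Proof.
move=> U1 UM XU; apply: agenv_sub_modl; first by rewrite -memvE.
by apply/prodvP => x y /(subvP (introT span_subvP XU)); apply: UM.
Qed.

Section Centralizers.
Variables (n : nat) (a : 'I_n -> A).

(** An increasing filtration from the centralizer of the whole family, at [k = 0], to [A], at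
    [k = n]; [cents i] is the kernel of [ad (a i)] on [cents i.+1]. *)
Definition cents k : {vspace A} := (\bigcap_(j < n | (k <= j)%N) 'C[a j])%VS.

Lemma centsP k x :
  reflect (forall j : 'I_n, (k <= j)%N -> x * a j = a j * x) (x \in cents k).
Proof.
by apply: (iffP (mem_bigcapv _ _ _)) => h j kj; apply/cent1vP/h.
Qed.

Lemma cents_last : cents n = fullv.
Proof.
by apply/vspaceP => x; rewrite memvf; apply/centsP => j; rewrite leqNgt ltn_ord.
Qed.

Lemma cents1 k : 1 \in cents k.
Proof. by apply/centsP => j _; rewrite mul1r mulr1. Qed.

Lemma cents_mul k x y : x \in cents k -> y \in cents k -> x * y \in cents k.
Proof.
move=> /centsP xa /centsP ya; apply/centsP => j kj.
by rewrite -mulrA ya // mulrA xa // mulrA.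
Qed.

Lemma centsS k l : (k <= l)%N -> (cents k <= cents l)%VS.
Proof.
move=> kl; apply/subvP => x /centsP xa; apply/centsP => j lj; apply: xa.
exact: leq_trans lj.
Qed.

Lemma cents_stepP (i : 'I_n) x :
  reflect (x \in cents i.+1 /\ ad (a i) x = 0) (x \in cents i).
Proof.
apply: (iffP idP) => [xi|[/centsP xa /ad_eq0 xi]].
  split; first exact: (subvP (centsS (leqnSn i))).
  by apply/ad_comm/esym; apply: (centsP _ _ xi).
apply/centsP => j; rewrite leq_eqVlt => /predU1P [ij|]; last exact: xa.
by rewrite -(val_inj ij).
Qed.

Lemma ad_cents k x y : x \in cents k -> y \in cents k -> ad x y \in cents k.
Proof. by move=> xa ya; rewrite adE rpredD ?cents_mul. Qed.

Hypothesis a_comm : forall i j, a i * a j = a j * a i.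
Hypothesis a_sqr : forall i, a i * a i \in 1%VS.

Lemma a_cents i k : a i \in cents k.
Proof. by apply/centsP => j _; apply: a_comm. Qed.

(** The square of [a i] is scalar, so [ad (a i)] squares to zero and maps [cents i.+1] into its
    kernel [cents i]. *)
Lemma dim_cents_step (i : 'I_n) :
  (\dim (cents i.+1) <= 2 * \dim (cents i))%N /\
  ((2 * \dim (cents i) <= \dim (cents i.+1))%N ->
   (cents i <= ad (a i) @: cents i.+1)%VS).
Proof.
apply: dim_ker_le => [x|x xa]; first exact: cents_stepP.
apply/cents_stepP; split; first by rewrite ad_cents ?a_cents.
exact: ad_idem_sqr.
Qed.

Lemma dim_cents_le k : (k <= n)%N -> (\dim (cents k) <= 2 ^ k * \dim (cents 0))%N.
Proof.
elim: k => [|k IH] kn; first by rewrite mul1n.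
have [le _] := dim_cents_step (Ordinal kn).
by apply: leq_trans le _; rewrite expnS -mulnA leq_mul2l IH // ltnW.
Qed.

Lemma dim_cents_ge k : (k <= n)%N ->
  (\dim (fullv : {vspace A}) <= 2 ^ (n - k) * \dim (cents k))%N.
Proof.
move=> kn; rewrite -{2}(subKn kn); move: (n - k)%N (leq_subr k n) => d.
elim: d => [|d IH] dn; first by rewrite subn0 cents_last mul1n.
have ltn : (n - d.+1 < n)%N by lia.
have [le _] := dim_cents_step (Ordinal ltn); move: le => /=.
rewrite -subSn // subSS => le; apply: leq_trans (IH (ltnW dn)) _.
by rewrite expnSr -mulnA leq_mul2l le orbT.
Qed.
End Centralizers.
End CharTwo.

(** * Alternating and symmetric elements of an orthogonal involution *)

Section Involution.
Variables (F : fieldType) (A : falgType F) (s : 'End(A)).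
Hypothesis charF : (2 \in [pchar F])%N.
Hypothesis sM : forall x y, s (x * y) = s y * s x.
Hypothesis sK : forall x, s (s x) = x.
Hypothesis s_orth : forall x, x + s x != 1.
Implicit Types (x y z : A) (Q S T : {vspace A}).

Let sD x y : s (x + y) = s x + s y. Proof. exact: linearD. Qed.
Let sZ c x : s (c *: x) = c *: s x. Proof. exact: linearZ. Qed.

(** In characteristic two [1 + s] is [1 - s]: its image is the space of alternating elements, its
    kernel that of symmetric ones. *)
Definition Alt : {vspace A} := limg (\1%VF + s).
Definition Sym : {vspace A} := lker (\1%VF + s).

Lemma AltP x : reflect (exists y, x = y + s y) (x \in Alt).
Proof.
apply: (iffP memv_imgP) => [[y _ ->]|[y ->]].
  by exists y; rewrite add_lfunE id_lfunE.
by exists y; rewrite ?memvf // add_lfunE id_lfunE.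
Qed.

Lemma SymP x : reflect (s x = x) (x \in Sym).
Proof.
rewrite memv_ker add_lfunE id_lfunE; apply: (iffP eqP) => [h|->].
  by apply/esym/(addv_eq0_char2 charF).
by rewrite (addvv_char2 charF).
Qed.

Lemma s1 : s 1 = 1.
Proof. by have := sM (s 1) 1; rewrite mulr1 sK mulr1 => <-. Qed.

Lemma Alt_conj a x : x \in Alt -> a * x * s a \in Alt.
Proof.
move=> /AltP [y ->]; apply/AltP; exists (a * y * s a).
by rewrite !sM sK mulrDr mulrDl !mulrA.
Qed.

(** A nonzero scalar in [Alt] could be rescaled to [1], which orthogonality excludes. *)
Lemma Alt_scalar x : x \in Alt -> x \in 1%VS -> x = 0.
Proof.
move=> xA /mem1vP [c cx]; move: xA; rewrite {}cx; have [->|c0] := eqVneq c 0.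
  by rewrite scale0r.
move=> /AltP [y cy]; have := s_orth (c^-1 *: y).
by rewrite sZ -scalerDr -cy scalerA mulVf // scale1r eqxx.
Qed.

Lemma Alt_sub_Sym : (Alt <= Sym)%VS.
Proof.
by apply/subvP => _ /AltP [y ->]; apply/SymP; rewrite sD sK addrC.
Qed.

Lemma one_notin_Alt : 1 \notin Alt.
Proof. by apply/negP => /AltP [y /esym/eqP]; rewrite (negPf (s_orth y)). Qed.

(** * Symmetric generators of a quaternion algebra with involution *)

Section Quaternion.
Variable Q : {vspace A}.
Hypothesis Qquat : quaternion_subalg Q.
Hypothesis sQ : forall x, x \in Q -> s x \in Q.

Let Q1 : 1 \in Q. Proof. by case: Qquat => [[[]]]. Qed.
Let QM x y : x \in Q -> y \in Q -> x * y \in Q.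
Proof. by move=> xQ yQ; case: Qquat => [[[_ /prodvP QQ] _ _ _] _]; apply: QQ. Qed.

Lemma quat_noncomm : ~ {in Q &, forall x y, x * y = y * x}.
Proof.
move=> QC; case: Qquat => [[_ ZQ _ _] dQ].
have : Q = 1%VS by rewrite -ZQ; apply/esym/capv_idPl/centvsP.
by move=> /(congr1 (fun U : {vspace A} => \dim U)); rewrite dQ dimv1.
Qed.

(** The hypothesis makes [Q * z] a nonzero two-sided ideal of [Q], hence all of [Q] by
    simplicity. *)
Lemma normal_unit z : z \in Q -> z != 0 ->
    (forall x, x \in Q -> exists2 y, y \in Q & z * x = y * z) ->
  exists2 w, w \in Q & w * z = 1.
Proof.
move=> zQ z0 zN; pose J := (amulr z @: Q)%VS.
have JP x : reflect (exists2 y, y \in Q & x = y * z) (x \in J).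
  by apply: (iffP memv_imgP) => -[y yQ ->]; exists y => //; rewrite lfunE.
case: Qquat => [[_ _ _ simpleQ] _].
have [|J0|JQ] := simpleQ J.
- split=> [|a _ aQ /JP [y yQ ->]].
    by apply/subvP => _ /JP [y yQ ->]; exact: QM.
  have [a' a'Q za] := zN a aQ.
  split; apply/JP; first by exists (a * y); rewrite ?mulrA ?QM.
  by exists (y * a'); rewrite ?QM // -mulrA za mulrA.
- have : z \in J by apply/JP; exists 1; rewrite ?mul1r.
  by rewrite J0 memv0 (negPf z0).
- have /JP [w wQ w1] : 1 \in J by rewrite JQ.
  by exists w.
Qed.

(* [1 + s] squares to [0] on [Q], and [1] lies in its kernel but not in its
   image, so the image has dimension less than two. *)
Lemma quat_Alt_line : exists v, [/\ v \in Q, v != 0,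
    (exists2 y, y \in Q & y + s y = v) & forall x, x \in Q -> exists c, x + s x = c *: v].
Proof.
pose AQ := ((\1%VF + s)%R @: Q)%VS.
have memAQ x : x \in Q -> x + s x \in AQ.
  by move=> xQ; rewrite -[x in x + _]id_lfunE -add_lfunE memv_img.
have AQsub : (AQ <= Q :&: Sym)%VS.
  apply/subvP => _ /memv_imgP [x xQ ->]; rewrite add_lfunE id_lfunE memv_cap.
  by rewrite rpredD ?sQ //=; apply/SymP; rewrite sD sK addrC.
have AQAlt : (AQ <= Alt)%VS by apply/limgS/subvf.
have : (\dim AQ < \dim (Q :&: Sym))%N.
  rewrite (ltn_leqif (dimv_leqif_sup AQsub)); apply/negP => /subvP /(_ 1).
  rewrite memv_cap Q1 (introT (SymP 1) s1) => /(_ isT) /(subvP AQAlt).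
  by rewrite (negPf one_notin_Alt).
have := limg_ker_dim (\1%VF + s) Q; rewrite -/AQ -/Sym; case: Qquat => _ -> dims lt.
(* Otherwise [s] would be the identity on [Q], and an antiautomorphism equal to the identity forces
   commutativity. *)
have AQ0 : AQ != 0%VS.
  apply/eqP => AQ0; apply: quat_noncomm => x y xQ yQ.
  have fixQ z : z \in Q -> s z = z.
    move=> /memAQ; rewrite AQ0 memv0 => /eqP /(addv_eq0_char2 charF).
    by move=> {1}->.
  by rewrite -[LHS]fixQ ?QM // sM !fixQ.
have v0 : vpick AQ != 0 by rewrite vpick0.
exists (vpick AQ); split => //.
- by have /(subvP AQsub) := memv_pick AQ; rewrite memv_cap => /andP [].
- have /memv_imgP [y yQ ->] := memv_pick AQ.
  by exists y; rewrite // add_lfunE id_lfunE.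
move=> x /memAQ xAQ; apply/vlineP; suff <- : AQ = <[vpick AQ]>%VS by [].
apply/esym/eqP; rewrite eqEdim -memvE memv_pick dim_vline v0 /=.
by lia.
Qed.

(** Take [v] spanning the alternating line. The alternating elements [x * v + v * s x] and
    [x * v * s x] are multiples of [v], with the trace and the norm of [x] as coefficients. Then [u]
    is a rescaled symmetric element that does not commute with [v]. *)
Lemma quat_gens : exists u v, [/\ u \in Q /\ v \in Q, s u = u /\ s v = v,
    u * v + v * u = v, exists a, u * u = u + a%:A
  & exists2 b, b != 0 & v * v = b%:A].
Proof.
have [v [vQ v0 [y yQ yv] AltQ]] := quat_Alt_line.
have vAlt : v \in Alt by apply/AltP; exists y.
have sv : s v = v by apply/SymP/(subvP Alt_sub_Sym).
have tr x : x \in Q -> exists c, x * v + v * s x = c *: v.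
  move=> xQ; have [|c cE] := AltQ (x * v); first exact: QM.
  by exists c; rewrite -cE sM sv.
have nrm x : x \in Q -> exists c, x * v * s x = c *: v.
  move=> xQ; have [|c cE] := AltQ (x * y * s x); first by rewrite !QM ?sQ.
  by exists c; rewrite -cE !sM sK -yv mulrDr mulrDl !mulrA.
(* The trace relation for [s x] reads [v * x = (c + s x) * v]. *)
have [|w wQ wv] := normal_unit vQ v0.
  move=> x xQ; have [|c cE] := tr (s x); first exact: sQ.
  exists (c%:A + s x); first by rewrite rpredD ?sQ ?rpredZ.
  rewrite mulrDl -scalerAl mul1r -cE sK; nc2 charF.
have [b vv] : exists b, v * v = b%:A.
  have [c cE] := nrm v vQ; exists c.
  have vvv : v * v * v = c *: v by rewrite -cE sv.
  by rewrite -[LHS]mul1r -wv -mulrA (mulrA v) vvv -scalerAr wv.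
have b0 : b != 0.
  by apply: contra_neq v0 => b0; rewrite -[v]mul1r -wv -mulrA vv b0 scale0r mulr0.
pose vi := b^-1 *: v.
have viv : vi * v = 1 by rewrite -scalerAl vv scalerA mulVf ?scale1r.
have vvi : v * vi = 1 by rewrite -scalerAr vv scalerA mulVf ?scale1r.
(* A symmetric element outside the centralizer of [v] yields [u]; the rest of the proof refutes the
   case where there is none. *)
have [comm|] := boolP (Q :&: Sym <= 'C[v])%VS; last first.
  case/subvPn => u; rewrite memv_cap => /andP [uQ /SymP su] /cent1vP uv.
  have [c] := tr u uQ; rewrite su => cE.
  have c0 : c != 0.
    apply/eqP => c0; apply: uv; apply: (addv_eq0_char2 charF).
    by rewrite cE c0 scale0r.
  pose u' := c^-1 *: u.
  have u'v : u' * v + v * u' = v.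
    by rewrite -scalerAl -scalerAr -scalerDr cE scalerA mulVf ?scale1r.
  have su' : s u' = u' by rewrite sZ su.
  have u'Q : u' \in Q by rewrite rpredZ.
  clearbody u'; exists u', v; split=> //; last by exists b.
  (* Substituting [u' * v = v + v * u'] into the norm relation and cancelling [v] gives
     [u' + u' * u' = d]. *)
  have [d dE] := nrm u' u'Q; exists d; apply: (addv_eq0_char2 charF).
  have -> : d%:A = vi * (u' * v * s u') by rewrite dE -scalerAr viv.
  rewrite su' -[in X in _ + X](addKv_char2 charF (v * u') (u' * v)).
  rewrite [v * u' + u' * v]addrC u'v mulrDl mulrDr -!mulrA !(mulrA vi) viv.
  nc2 charF.
(* An antiautomorphism of [Q] that moves each element by a scalar, its trace. In the present case it
   fixes all symmetric elements, so it is determined by its value at [y], which spans a complement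
   to them in [Q]. *)
pose gam x := vi * s x * v.
have gamM x x' : gam (x * x') = gam x' * gam x.
  by rewrite /gam sM !mulrA -(mulrA _ v vi) vvi mulr1.
have gamD x x' : gam (x + x') = gam x + gam x'.
  by rewrite /gam sD mulrDr mulrDl.
have gamZ (c : F) x : gam (c *: x) = c *: gam x.
  by rewrite /gam sZ -scalerAr -scalerAl.
have gamQ x : x \in Q -> gam x \in Q.
  by move=> xQ; rewrite !QM ?sQ ?rpredZ.
have gamT x : x \in Q -> exists c, gam x = x + c%:A.
  move=> xQ; have [c cE] := tr x xQ; exists c.
  have -> : c%:A = (c *: v) * vi by rewrite -scalerAl vvi.
  rewrite -cE mulrDl -!mulrA vvi mulr1 (addKv_char2 charF) /gam /vi.
  by rewrite -!scalerAl -!scalerAr mulrA.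
have gam_sym x : x \in Q -> s x = x -> gam x = x.
  move=> xQ sx; have /(subvP comm)/cent1vP xv : x \in (Q :&: Sym)%VS.
    by rewrite memv_cap xQ; apply/SymP.
  by rewrite /gam sx -mulrA xv mulrA viv mul1r.
have splitQ x : x \in Q -> exists c x0, [/\ x0 \in Q, s x0 = x0 & x = x0 + c *: y].
  move=> xQ; have [c cE] := AltQ x xQ; exists c, (x + c *: y).
  split; first by rewrite rpredD ?rpredZ.
    rewrite sD sZ; apply/esym/(addv_eq0_char2 charF).
    rewrite addrACA cE -scalerDr yv (addvv_char2 charF) //.
  by rewrite -addrA (addvv_char2 charF) addr0.
have [t tE] := gamT y yQ; have [|k kE] := gamT (v * y); first exact: QM.
have gamv : gam v = v by exact: gam_sym.
have noncomm := quat_noncomm.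
have t0 : t != 0.
  apply/eqP => t0; rewrite t0 scale0r addr0 in tE.
  have gam_id x : x \in Q -> gam x = x.
    move=> /splitQ [c [x0 [x0Q sx0 ->]]].
    by rewrite gamD gamZ tE gam_sym.
  by apply: noncomm => x x' xQ x'Q; rewrite -[LHS]gam_id ?QM // gamM !gam_id.
(* The scalars by which [gam] moves [y] and [v * y] cancel in [z * y]. Hence [gam] fixes every
   [z * x], which amounts to [gam x * z = z * x]. *)
pose z := k%:A + t *: v.
have zQ : z \in Q by rewrite rpredD ?rpredZ.
have gamz x : x \in Q -> gam (z * x) = z * x.
  move=> /splitQ [c [x0 [x0Q sx0 ->]]].
  have x0v : x0 * v = v * x0.
    by have /(subvP comm)/cent1vP : x0 \in (Q :&: Sym)%VS
      by rewrite memv_cap x0Q; apply/SymP.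
  rewrite mulrDr gamD -scalerAr gamZ; congr (_ + _ *: _).
    by rewrite mulrDl -!scalerAl mul1r gamD !gamZ gamM gamv gam_sym // x0v.
  rewrite mulrDl -!scalerAl mul1r gamD !gamZ kE tE !scalerDr !scalerA (mulrC t).
  cancel2 charF.
have {}gamz x : x \in Q -> gam x * z = z * x.
  have gz : gam z = z by have := gamz 1 Q1; rewrite mulr1.
  by move=> xQ; rewrite -gamz // gamM gz.
have [z0|z0] := eqVneq z 0.
  have : v \in 1%VS.
    apply/mem1vP; exists (t^-1 * k); rewrite -scalerA.
    have -> : k%:A = t *: v by apply: (addv_eq0_char2 charF).
    by rewrite scalerA mulVf ?scale1r.
  by move/(Alt_scalar vAlt)/eqP; rewrite (negPf v0).
(* Now [z] is invertible by [normal_unit], and [z * x * x' = gam x' * gam x * z = z * x' * x] makes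
   [Q] commutative. *)
case: noncomm => x x' xQ x'Q.
have [x1 x1Q|w' w'Q w'z] := normal_unit zQ z0.
  by exists (gam x1); rewrite ?gamQ ?gamz.
rewrite -[LHS]mul1r -[RHS]mul1r -w'z -!mulrA; congr (_ * _).
transitivity (gam (x * x') * z); first by rewrite gamz ?QM.
rewrite gamM -(mulrA (gam x')) (gamz x) // (mulrA (gam x')) (gamz x') //.
by rewrite mulrA.
Qed.
End Quaternion.

(** * The inseparable subalgebra attached to a decomposition *)

Section Frame.
Variables (n : nat) (u v : 'I_n -> A).
Hypothesis su : forall i, s (u i) = u i.
Hypothesis sv : forall i, s (v i) = v i.
Hypothesis uv : forall i, u i * v i + v i * u i = v i.
Hypothesis uu : forall i, exists a, u i * u i = u i + a%:A.
Hypothesis vv : forall i, exists2 b, b != 0 & v i * v i = b%:A.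
Hypothesis uuC : forall i j, u i * u j = u j * u i.
Hypothesis vvC : forall i j, v i * v j = v j * v i.
Hypothesis uvC : forall i j, i != j -> u i * v j = v j * u i.
Hypothesis dimA : \dim (fullv : {vspace A}) = (4 ^ n)%N.

Let addvv := addvv_char2 charF (A := A).
Let ad_comm := ad_comm charF (A := A).
Let ad_eq0 := ad_eq0 charF (A := A).

(** Defining it as a centralizer puts its dimension within reach of the kernel chains; [Sv_gen]
    shows that the [v i] generate it. *)
Definition Sv : {vspace A} := cents v 0.
(* The subalgebra generated by the [v j] with [j < k]. *)
Definition Svk k : {vspace A} := (Sv :&: cents u k)%VS.

Lemma SvP x : reflect (forall j, x * v j = v j * x) (x \in Sv).
Proof. by apply: (iffP (centsP _ _ _)) => h j //; apply: h. Qed.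

Lemma v_unit i : v i \is a GRing.unit.
Proof. by have [b b0 bv] := vv i; apply: scalar_unit b0 bv. Qed.

Lemma comm_vV x i : x * v i = v i * x -> x * (v i)^-1 = (v i)^-1 * x.
Proof.
move=> xv; apply: (mulIr (v_unit i)); rewrite -[LHS]mulrA mulVr ?v_unit // mulr1.
by rewrite -mulrA xv mulrA mulVr ?v_unit // mul1r.
Qed.

Lemma uvD i : u i * v i = v i + v i * u i.
Proof. by rewrite -[X in X + _]uv -addrA addvv addr0. Qed.

Lemma vVu i : (v i)^-1 * u i = u i * (v i)^-1 + (v i)^-1.
Proof.
apply: (mulrI (v_unit i)); apply: (mulIr (v_unit i)).
rewrite mulrDr mulrDl !mulrA divrr ?v_unit // !mul1r -!mulrA mulVr ?v_unit // mulr1.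
by rewrite uvD addrC.
Qed.

Lemma v_sqr i : v i * v i \in 1%VS.
Proof. by have [b _ ->] := vv i; apply/mem1vP; exists b. Qed.

Lemma v_in_Sv i : v i \in Sv. Proof. exact: a_cents. Qed.

Lemma Sv1 : 1 \in Sv. Proof. exact: cents1. Qed.

Lemma SvM x y : x \in Sv -> y \in Sv -> x * y \in Sv. Proof. exact: cents_mul. Qed.

Lemma SvV i : (v i)^-1 \in Sv.
Proof. by apply/SvP => j; rewrite comm_vV. Qed.

Let pow4 : (4 ^ n = 2 ^ n * 2 ^ n)%N := expnMn 2 2 n.

Lemma dim_Sv : \dim Sv = (2 ^ n)%N.
Proof.
apply/eqP; rewrite eqn_leq; apply/andP; split; last first.
  have := dim_cents_le charF vvC v_sqr (leqnn n).
  by rewrite cents_last dimA pow4 leq_pmul2l ?expn_gt0.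
have := @dim_ker_chain _ _ n 0%VS (cents v) (fun i => ad (v i)).
rewrite cents_last dimA dimv0 !subn0 pow4 leq_pmul2l ?expn_gt0 //.
apply=> [k|i x|i y yi]; first exact: sub0v.
  by rewrite memv0; apply: (iffP (cents_stepP charF v i x)) => -[? /eqP].
have yiv : y * v i = v i * y by apply: (centsP _ _ _ yi).
(* [ad (v i)] sends [u i * (v i)^-1] to [1], and [y] commutes with [v i]. *)
exists (u i * (v i)^-1 * y).
  apply: cents_mul; last by apply: (subvP (centsS v (leqnSn i))).
  apply: cents_mul; last by apply: (subvP (centsS v (leq0n _))); exact: SvV.
  by apply/centsP => j ij; rewrite uvC //; apply: contraTneq ij => ->; rewrite ltnn.
rewrite memv0 subr_eq0 adE; apply/eqP.
rewrite -[X in _ + X]mulrA yiv -!mulrA (mulKr (v_unit i)) !mulrA.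
rewrite -[v i * u i](addKv_char2 charF (u i * v i)) (addrC _ (v i * _)) addrA uv.
rewrite !mulrDl divrr ?v_unit // mul1r mulrK ?v_unit //.
by rewrite -addrA addvv addr0.
Qed.

(** [ad (u i)] squares to the derivation of [u i * u i], which differs from [u i] by a scalar. *)
Lemma ad_u_idem i x : ad (u i) (ad (u i) x) = ad (u i) x.
Proof.
have [a ua] := uu i; rewrite !adE !mulrDr !mulrDl !mulrA -(mulrA x) ua.
nc2 charF.
Qed.

Lemma ad_u_comm_v i j x :
  x * v j = v j * x -> ad (u i) x * v j = v j * ad (u i) x.
Proof.
move=> xv; rewrite adE mulrDl mulrDr -!mulrA xv !mulrA.
have [ij|ij] := eqVneq i j; first subst j.
  rewrite uvD -(mulrA x) uvD !mulrDr !mulrDl !mulrA xv.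
  cancel2 charF.
by rewrite uvC // -(mulrA x) uvC // mulrA xv.
Qed.

Lemma ad_u_Sv i x : x \in Sv -> ad (u i) x \in Sv.
Proof. by move=> /SvP xv; apply/SvP => j; apply: ad_u_comm_v. Qed.

Lemma uVvC i j : i != j -> u i * (v j)^-1 = (v j)^-1 * u i.
Proof. by move=> ij; rewrite comm_vV // uvC. Qed.

(** Both [ad (u i) x] and [(v i)^-1] are fixed by the derivation [ad (u i)], so the two terms of the
    product rule cancel. *)
Lemma ad_u_div_comm i x :
  ad (u i) x * (v i)^-1 * u i = u i * (ad (u i) x * (v i)^-1).
Proof.
have := ad_u_idem i x; set y := ad _ x; rewrite adE => uy.
rewrite -mulrA vVu mulrDr !mulrA.
have -> : u i * y = y * u i + y by rewrite -[X in _ + X]uy; cancel2 charF.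
by rewrite mulrDl.
Qed.

Lemma cents_u_div (i : 'I_n) x : x \in cents u i.+1 ->
  ad (u i) x * (v i)^-1 \in cents u i.
Proof.
move=> xu; apply/centsP => j; rewrite leq_eqVlt => /predU1P [ij|ij].
  by rewrite -(val_inj ij) ad_u_div_comm.
have ji : j != i by apply: contraTneq ij => ->; rewrite ltnn.
rewrite -mulrA -uVvC // !mulrA; congr (_ * _).
by apply: (centsP _ _ _ (ad_cents (a_cents uuC _ _) xu)).
Qed.

(** The map [x -> ad (u i) x * (v i)^-1] vanishes exactly on the centralizer of [u i], and sends
    [y * v i] back to [y] for [y] in that centralizer. The cases of interest are [U = A] and
    [U = Sv]. *)
Lemma dim_chain_u (U : {vspace A}) :
    (forall i x, x \in U -> x * v i \in U) ->
  (2 ^ n * \dim (U :&: cents u 0) <= \dim U)%N.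
Proof.
move=> UV.
have := @dim_ker_chain _ _ n 0%VS (fun k => U :&: cents u k)%VS
  (fun i => amulr (v i)^-1%R \o ad (u i))%VF.
rewrite cents_last capvf dimv0 !subn0.
apply=> [k|i x|i y]; first exact: sub0v.
  rewrite memv0 comp_lfunE lfunE /= mulIr_eq0; last first.
    by apply/mulIr; rewrite unitrV v_unit.
  rewrite !memv_cap; apply: (iffP andP).
    by case=> -> /(cents_stepP charF) [-> ->].
  by case=> /andP [-> ?] /eqP ?; split=> //; apply/(cents_stepP charF).
rewrite memv_cap => /andP [yU yi]; exists (y * v i).
  rewrite memv_cap UV //; apply/centsP => j ij.
  have ji : j != i by apply: contraTneq ij => ->; rewrite ltnn.
  by rewrite -mulrA -uvC // !mulrA (centsP _ _ _ yi) // ltnW.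
rewrite memv0 subr_eq0 comp_lfunE lfunE /= adE mulrA -(centsP _ _ _ yi) //.
by rewrite -!(mulrA y) -mulrDr uv mulrK ?v_unit.
Qed.

Lemma dim_cents_u : (\dim (cents u 0) <= 2 ^ n)%N.
Proof.
have := @dim_chain_u fullv (fun i x _ => memvf _).
by rewrite capfv dimA pow4 leq_pmul2l ?expn_gt0.
Qed.

Lemma Svk_last : Svk n = Sv.
Proof. by rewrite /Svk cents_last capvf. Qed.

Lemma Svk0 : Svk 0 = 1%VS.
Proof.
apply/esym/eqP; rewrite eqEdim dimv1 -memvE memv_cap Sv1 cents1 /=.
have := @dim_chain_u Sv (fun i x xS => SvM xS (v_in_Sv i)).
by rewrite dim_Sv -[X in (_ <= X)%N]muln1 leq_pmul2l ?expn_gt0.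
Qed.

(** This is the eigenspace decomposition for the idempotent [ad (u i)]; division by [v i] carries
    the eigenvalue [1] part into the eigenvalue [0] part. *)
Lemma Svk_split (i : 'I_n) x : x \in Svk i.+1 ->
  exists x0 b, [/\ x0 \in Svk i, b \in Svk i, ad (u i) x = b * v i & x = x0 + b * v i].
Proof.
rewrite memv_cap => /andP [xS xi].
exists (x + ad (u i) x), (ad (u i) x * (v i)^-1).
rewrite mulrVK ?v_unit // -addrA addvv addr0; split=> //.
  rewrite memv_cap rpredD ?ad_u_Sv //; apply/(cents_stepP charF); split.
    rewrite rpredD // ad_cents //; apply/centsP => j _; exact: uuC.
  by rewrite linearD /= ad_u_idem addvv.
by rewrite memv_cap cents_u_div // SvM ?SvV ?ad_u_Sv.
Qed.

Definition vs : seq A := [seq v i | i <- enum 'I_n].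

Lemma size_vs : size vs = n.
Proof. by rewrite size_map size_enum_ord. Qed.

Lemma mem_vs i : v i \in vs.
Proof. by rewrite map_f ?mem_enum. Qed.

Lemma Sv_gen : agenv <<vs>> = Sv.
Proof.
apply/eqP; rewrite eqEsubv; apply/andP; split.
  by apply: agenv_min; [exact: Sv1|exact: SvM|move=> _ /mapP [i _ ->]; exact: v_in_Sv].
rewrite -Svk_last; suff: forall k, (k <= n)%N -> (Svk k <= agenv <<vs>>)%VS by apply.
elim=> [|k IH] kn; first by rewrite Svk0 sub1_agenv.
apply/subvP => x /(@Svk_split (Ordinal kn)) [x0 [b [x0S bS _ ->]]].
have sub := subvP (IH (ltnW kn)).
apply: rpredD; first exact: sub.
apply: (memvM (A := agenv_aspace <<vs>>)); first exact: sub.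
by apply: (subvP (sub_agenv _)); rewrite memv_span ?mem_vs.
Qed.

Lemma SvC x y : x \in Sv -> y \in Sv -> x * y = y * x.
Proof.
move=> xS /SvP yv; apply/cent1vP; move: x xS; apply/subvP; rewrite -Sv_gen.
apply: agenv_min => [|a b|_ /mapP [i _ ->]]; first exact: cent1v1.
  exact: (memvM (A := 'C[y]%AS)).
by apply/cent1vP; rewrite yv.
Qed.

Lemma cent_Sv : 'C(Sv)%VS = Sv.
Proof.
apply/vspaceP => x; apply/centvP/idP => [xC|xS y yS]; last exact: SvC.
by apply/SvP => j; apply/xC/v_in_Sv.
Qed.

Lemma Sv_sym x : x \in Sv -> s x = x.
Proof.
move=> xS; apply/SymP; move: x xS; apply/subvP.
suff: (Sv <= Sv :&: Sym)%VS by move/subv_trans; apply; apply: capvSr.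
rewrite -[X in (X <= _)%VS]Sv_gen; apply: agenv_min => [|x y|_ /mapP [i _ ->]].
- by rewrite memv_cap Sv1; apply/SymP; exact: s1.
- rewrite !memv_cap => /andP [xS /SymP sx] /andP [yS /SymP sy].
  by rewrite SvM //; apply/SymP; rewrite sM sx sy SvC.
- by rewrite memv_cap v_in_Sv; apply/SymP.
Qed.

(** Squaring is additive on the commutative algebra [Sv], so the claim propagates along
    [Svk_split]. *)
Lemma Sv_sqr x : x \in Sv -> x * x \in 1%VS.
Proof.
rewrite -Svk_last; suff: forall k, (k <= n)%N ->
  forall x, x \in Svk k -> x * x \in 1%VS by apply.
elim=> [_ y|k IH kn y /(@Svk_split (Ordinal kn)) [x0 [b [x0S bS _ ->]]]].
  by rewrite Svk0 => /mem1vP [c ->]; rewrite -scalerAl mul1r !rpredZ ?memv_line.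
set w := v _; have wS : w \in Sv := v_in_Sv _.
have [x0S' bS'] : x0 \in Sv /\ b \in Sv by split; apply: (subvP (capvSl _ _)); eassumption.
have -> : (x0 + b * w) * (x0 + b * w) = x0 * x0 + (b * b) * (w * w).
  rewrite mulrDl !mulrDr (SvC x0S' (SvM bS' wS)) -addrA addKv_char2 //.
  by rewrite !mulrA -(mulrA b w) (SvC wS bS') !mulrA.
have /mem1vP [c ->] := IH (ltnW kn) _ x0S.
have /mem1vP [d ->] := IH (ltnW kn) _ bS.
have /mem1vP [e ->] := v_sqr (Ordinal kn).
by rewrite -scalerAl mul1r; rewrite rpredD ?rpredZ ?memv_line.
Qed.

Lemma Sv_insep : inseparable_subalg s Sv.
Proof.
exists n; split=> //.
- by split; [split; [exact: Sv1|apply/prodvP => x y; exact: SvM]|exact: dim_Sv].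
- by move=> x xS; split; [exact: Sv_sym|exact: Sv_sqr].
- exact: cent_Sv.
- by exists vs; rewrite size_vs Sv_gen.
Qed.

(** * Anisotropy and uniqueness *)

Lemma nil_free_mem :
    (forall x, x \in Sv -> x * x = 0 -> x = 0) ->
  forall a, a * s a \in (1 + Alt)%VS -> a \in Sv.
Proof.
move=> nil a; have : a \in cents v n by rewrite cents_last memvf.
suff: forall k, (k <= n)%N ->
  forall a, a \in cents v k -> a * s a \in (1 + Alt)%VS -> a \in Sv by apply.
elim=> [//|k IH] kn {}a; pose i := Ordinal kn => ai.
case/memv_addP => _ /mem1vP [c ->] [t tAlt asa].
have [b b0 bv] := vv i.
(* [p] is the conjugate of [a] by [v i], so [y] commutes with [v i]. The scalar parts of [a * s a]
   and [p * s p] agree, so [y * s y] is alternating. By induction [y] lies in [Sv], where [y * y] is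
   scalar and alternating, hence zero; then [y = 0], and [a = p] commutes with [v i]. *)
pose p := b^-1 *: (v i * a * v i); pose y := a + p.
have vp : v i * p = a * v i.
  by rewrite /p -scalerAr !mulrA bv -!scalerAl mul1r scalerA mulVf // scale1r.
have pv : p * v i = v i * a.
  by rewrite /p -scalerAl -!mulrA bv -!scalerAr mulr1 scalerA mulVf // scale1r.
have yi : y \in cents v i.
  apply/(cents_stepP charF); split.
    by rewrite rpredD // rpredZ // !cents_mul // (a_cents vvC).
  by apply: ad_comm; rewrite mulrDl mulrDr vp pv addrC.
have sp : s p = b^-1 *: (v i * s a * v i) by rewrite sZ !sM sv mulrA.
have psp : p * s p = c%:A + b^-1 *: (v i * t * s (v i)).
  rewrite sp -scalerAr !mulrA pv -(mulrA (v i) a) asa sv.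
  rewrite mulrDr mulrDl scalerDr -scalerAr -scalerAl mulr1 bv !scalerA.
  by rewrite ?mulrA (mulrAC _ c) mulVf ?mul1r.
have ysy : y * s y \in Alt.
  have -> : y * s y = t + b^-1 *: (v i * t * s (v i)) + (a * s p + s (a * s p)).
    rewrite sM sK sD mulrDl !mulrDr asa psp.
    move: (v i * t * _) (a * s p) (p * s a) (c%:A) => x1 x2 x3 x4.
    cancel2 charF.
  apply: rpredD; last by apply/AltP; exists (a * s p).
  by apply: rpredD => //; apply/rpredZ/Alt_conj.
have yS : y \in Sv by apply: (IH (ltnW kn) y yi); apply: (subvP (addvSr _ _)).
have yy : y * y = 0.
  apply: Alt_scalar; last exact: Sv_sqr.
  by rewrite -{2}(Sv_sym yS).
have ap : a = p by apply: (addv_eq0_char2 charF); apply: nil.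
apply: (IH (ltnW kn)); last first.
  by rewrite asa memv_add //; apply/mem1vP; exists c.
apply/(cents_stepP charF v i); split=> //; apply: ad_comm.
by rewrite {2}ap pv.
Qed.

Lemma nil_free_anisotropic :
  (forall x, x \in Sv -> x * x = 0 -> x = 0) -> anisotropic s.
Proof.
move=> nil [x [x0 sxx]].
have sxS : s x \in Sv by apply: nil_free_mem nil _ _; rewrite sK sxx mem0v.
have sx : x = s x by rewrite -{1}(sK x) Sv_sym.
by case/eqP: x0; apply: nil; [rewrite sx|rewrite {1}sx].
Qed.

Lemma insep_dim T : inseparable_subalg s T -> \dim T = (2 ^ n)%N.
Proof.
case=> m [dm [_ ->] _ _ _]; move: dm; rewrite dimA => dm.
by rewrite (expnI _ dm).
Qed.

Lemma insep_sub_eq T : inseparable_subalg s T -> (T <= Sv)%VS -> Sv = T.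
Proof.
by move=> Tins TS; apply/esym/eqP; rewrite eqEdim TS dim_Sv insep_dim /=.
Qed.

Lemma anisotropic_insep_unique T :
  anisotropic s -> inseparable_subalg s T -> Sv = T.
Proof.
move=> aniso Tins; apply: insep_sub_eq => //; apply/subvP => x xT.
case: Tins => m [_ _ Tsym _ _]; have [sx xx] := Tsym x xT.
apply: nil_free_mem; last by rewrite sx; apply: (subvP (addvSl _ _)).
move=> y yS yy; apply/eqP/negPn/negP => y0; apply: aniso; exists y.
by rewrite Sv_sym.
Qed.

(** * Inseparable subalgebras lie in [F + Alt] *)

Lemma Sym_sub_Alt_cents : (Sym <= Alt + cents u 0)%VS.
Proof.
suff: forall k, (k <= n)%N -> (Sym :&: cents u k <= Alt + cents u 0)%VS.
  by move=> /(_ n (leqnn n)); rewrite cents_last capvf.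
elim=> [|k IH] kn; first exact: subv_trans (capvSr _ _) (addvSr _ _).
apply/subvP => x; pose i := Ordinal kn.
rewrite memv_cap => /andP [/SymP sx xi].
(* The second summand is alternating, and the first commutes with [u i] because [ad (u i)] is
   idempotent. *)
have -> : x = (x + ad (u i) x) + ad (u i) x by rewrite -addrA addvv addr0.
have uxAlt : ad (u i) x \in Alt.
  by apply/AltP; exists (u i * x); rewrite adE sM sx su.
apply: rpredD; last exact: (subvP (addvSl _ _)).
apply: (subvP (IH (ltnW kn))); rewrite memv_cap; apply/andP; split.
  by rewrite rpredD //; [exact/SymP|exact: (subvP Alt_sub_Sym)].
apply/(cents_stepP charF u i); split.
  by rewrite rpredD // ad_cents ?(a_cents uuC).
by rewrite linearD /= ad_u_idem addvv.
Qed.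

Lemma dim_Sym : (\dim Sym - \dim Alt <= 2 ^ n)%N.
Proof.
have := dimvS Sym_sub_Alt_cents; have := (dimv_add_leqif Alt (cents u 0)).1.
by have := dim_cents_u; lia.
Qed.

Lemma insep_sub_Alt T : inseparable_subalg s T -> (T <= 1 + Alt)%VS.
Proof.
move=> Tins; have dimT := insep_dim Tins.
case: Tins => m [dm [T_alg _] Tsym CT [xs [size_xs genT]]].
have {dm} mn : m = n by move: dm; rewrite dimA => dm; rewrite (expnI _ dm).
rewrite {}mn in size_xs; pose w (i : 'I_n) := xs`_i.
have w_xs i : w i \in xs by rewrite mem_nth ?size_xs.
have wT i : w i \in T.
  by rewrite -genT; apply: (subvP (sub_agenv _)); rewrite memv_span.
have TC x y : x \in T -> y \in T -> x * y = y * x.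
  by move=> xT yT; move: xT; rewrite -{1}CT => /centvP; apply.
have ws i : s (w i) = w i by have [] := Tsym _ (wT i).
have w_sqr i : w i * w i \in 1%VS by have [] := Tsym _ (wT i).
have wC i j : w i * w j = w j * w i by exact: TC.
have cwT : cents w 0 = T.
  apply/vspaceP => x; apply/idP/idP => [/centsP xw|xT]; last first.
    by apply/centsP => j _; exact: TC.
  rewrite -CT; apply/centvP => y yT; apply/esym/cent1vP; move: y yT; apply/subvP.
  rewrite -genT; apply: agenv_min => [|a b|a /(nthP 0) [j]]; first exact: cent1v1.
    exact: (memvM (A := 'C[x]%AS)).
  by rewrite size_xs => jn <-; apply/cent1vP; rewrite -[xs`_j]/(w (Ordinal jn)) xw.
(* Halving is forced at each step by [dim A = 4 ^ n] and [dim T = 2 ^ n], so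
   the square-zero map [ad (w i)] is exact on [cents w i.+1]. *)
have exU (i : 'I_n) : exists2 U, U \in cents w i.+1 & ad (w i) U = 1.
  have [_ exact_i] := dim_cents_step charF wC w_sqr i.
  have /exact_i : (2 * \dim (cents w i) <= \dim (cents w i.+1))%N.
    have le := dim_cents_le charF wC w_sqr (ltnW (ltn_ord i)).
    have ge := dim_cents_ge charF wC w_sqr (ltn_ord i).
    rewrite cwT dimT -expnD in le; rewrite dimA pow4 -expnD in ge.
    rewrite -(leq_pmul2l (m := 2 ^ (n - i.+1))) ?expn_gt0 //.
    apply: leq_trans ge; rewrite mulnA -expnSr.
    apply: leq_trans (leq_mul (leqnn _) le) _.
    by rewrite -expnD leq_exp2l //; have := ltn_ord i; lia.
  by move=> /subvP /(_ 1 (cents1 _ _)) /memv_imgP [U Ui ->]; exists U.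
(* As [w i] is symmetric, on [Sym/Alt] this is the operator [a.[y] + a^2 [y]] for [a = w i]. *)
pose Z i : 'End(A) := (amulr (w i) \o amull (w i) + amull (w i * w i))%VF.
have ZE i y : Z i y = w i * y * w i + w i * w i * y.
  by rewrite add_lfunE comp_lfunE !lfunE.
have ZAlt i y : y \in Alt -> Z i y \in Alt.
  move=> yA; rewrite ZE rpredD //; first by rewrite -{2}ws Alt_conj.
  by have /mem1vP [c ->] := w_sqr i; rewrite -scalerAl mul1r rpredZ.
pose W k := (Sym :&: \bigcap_(j < n | (k <= j)%N) (Z j @^-1: Alt))%VS.
have WP k y : reflect (s y = y /\ forall j : 'I_n, (k <= j)%N -> Z j y \in Alt)
    (y \in W k).
  rewrite memv_cap; apply: (iffP andP) => -[ys yZ]; split; try exact/SymP.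
    by move=> j kj; rewrite memv_preim; apply: (mem_bigcapv _ _ _ yZ).
  by apply/mem_bigcapv => j kj; rewrite -memv_preim yZ.
have := @dim_ker_chain _ _ n Alt W Z.
have WE : W n = Sym.
  apply/capv_idPl/subvP => x _; apply/mem_bigcapv => j.
  by rewrite leqNgt ltn_ord.
have AltW k : (Alt <= W k)%VS.
  apply/subvP => x xA; apply/WP; split=> [|j _]; last exact: ZAlt.
  exact/SymP/(subvP Alt_sub_Sym).
rewrite WE => /(_ AltW) chain.
have {}chain : (2 ^ n * (\dim (W 0) - \dim Alt) <= \dim Sym - \dim Alt)%N.
  apply: chain => [i x|i y yW].
    apply: (iffP (WP _ _)) => [[sx xZ]|[/WP [sx xZ] Zi]].
      by split; [apply/WP; split=> // j ij; apply/xZ/ltnW|apply: xZ].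
    split=> // j; rewrite leq_eqVlt => /predU1P [ij|]; last exact: xZ.
    by rewrite -(val_inj ij).
  have [sy yZ] := WP _ _ yW; have [U Ui wU] := exU i.
  have UZ j : w j * U = U * w j -> Z j (U * y * s U) = U * Z j y * s U.
    move=> wjU; have wjsU : w j * s U = s U * w j.
      by have := congr1 s wjU; rewrite !sM ws => ->.
    have /mem1vP [c wwc] := w_sqr j.
    rewrite !ZE mulrDr mulrDl wwc -!scalerAl -!scalerAr !mul1r -scalerAl.
    by rewrite !mulrA wjU -!mulrA wjsU.
  (* Moving [w i] past [U] and [s U] leaves [y], the alternating element [U * Z i y * s U], and a
     cross term together with its image under [s]. *)
  exists (U * y * s U).
    apply/WP; split=> [|j ij]; first by rewrite !sM sK sy mulrA.
    by rewrite UZ; [exact/Alt_conj/yZ/ltnW|rewrite (centsP _ _ _ Ui)].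
  have wUE : w i * U = U * w i + 1.
    by rewrite -wU adE; cancel2 charF.
  have sUw : s U * w i = w i * s U + 1.
    by have := congr1 s wUE; rewrite sD !sM ws s1.
  have -> : Z i (U * y * s U) - y =
      U * Z i y * s U + (U * w i * y + s (U * w i * y)).
    rewrite !sM ws sy !ZE; have /mem1vP [c ->] := w_sqr i.
    have -> : - y = y by apply: (addv_eq0_char2 charF); rewrite addNr.
    rewrite !mulrA wUE -(mulrA _ (s U)) sUw; nc2 charF.
  by rewrite rpredD ?Alt_conj ?yZ //; apply/AltP; exists (U * w i * y).
(* [Sym/Alt] has dimension at most [2 ^ n], so the chain leaves at most a line for [W 0] modulo
   [Alt]. *)
have W0E : (1 + Alt)%VS = W 0.
  apply/eqP; rewrite eqEdim; apply/andP; split.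
    rewrite subv_add AltW andbT -memvE; apply/WP; split=> [|j _]; first exact: s1.
    by rewrite ZE !mulr1 addvv mem0v.
  have -> : \dim (1 + Alt)%VS = (\dim Alt).+1.
    rewrite dimv_disjoint_sum ?dimv1 //; apply/eqP; rewrite -subv0.
    apply/subvP => x; rewrite memv_cap memv0 => /andP [x1 xA].
    exact/eqP/Alt_scalar.
  have := leq_trans chain dim_Sym; rewrite -[X in (_ <= X)%N]muln1.
  by rewrite leq_pmul2l ?expn_gt0 // leq_subLR addn1.
rewrite W0E; apply/subvP => x xT; apply/WP; split=> [|j _].
  by have [] := Tsym _ xT.
by rewrite ZE -[X in X + _]mulrA (TC x) // mulrA addvv mem0v.
Qed.

(** * Alternating elements with scalar square in degree at most four *)

Lemma mem_Svk0 x : x \in Sv -> (forall j, x * u j = u j * x) -> x \in 1%VS.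
Proof. by move=> xS xu; rewrite -Svk0 memv_cap xS; apply/centsP => j _. Qed.

Lemma ad_v_comm i z : ad z (v i) * v i = v i * ad z (v i).
Proof.
apply: ad_eq0; have -> : ad z (v i) = ad (v i) z by rewrite !adE addrC.
apply: ad_idem_sqr => //; exact: v_sqr.
Qed.

Lemma s_ad x y : s (ad x y) = ad (s x) (s y).
Proof. by rewrite !adE sD !sM addrC. Qed.

(** Since [ad (v i) (u i) = v i], the coefficient of [u i] has to be [(v i)^-1 * ad (v i) x]. *)
Lemma split_u (i : 'I_n) x : (forall j, j != i -> x * v j = v j * x) ->
  exists y0 y, [/\ y0 \in Sv, y \in Sv & x = y0 + u i * y].
Proof.
move=> xv; have [b b0 bv] := vv i.
pose y := b^-1 *: (v i * ad (v i) x).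
have vy : v i * y = ad (v i) x.
  by rewrite /y -scalerAr mulrA bv -scalerAl mul1r scalerA mulVf ?scale1r.
have yv : y * v i = v i * y.
  rewrite vy /y !adE -scalerAl mulrDr mulrDl !mulrA bv -[v i * x * v i * v i]mulrA bv.
  rewrite -!scalerAl -!scalerAr mul1r mulr1 -scalerDr scalerA mulVf // scale1r.
  by rewrite addrC.
have yS : y \in Sv.
  apply/SvP => j; have [->//|ji] := eqVneq j i.
  have := cent_ad (vvC i j) (xv _ ji).
  by rewrite /y -scalerAl -scalerAr -!mulrA => ->; rewrite !mulrA vvC.
exists (x + u i * y), y; split=> //; last by rewrite -addrA addvv addr0.
apply/SvP => j; have [->|ji] := eqVneq j i; last first.
  rewrite mulrDl mulrDr xv // -mulrA (SvP _ yS) !mulrA uvC //.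
  by rewrite eq_sym.
rewrite mulrDl mulrDr -mulrA yv mulrA uvD mulrDl vy adE.
rewrite -[v i * u i * y]mulrA; cancel2 charF.
Qed.

Section TwoIndices.
Variables (i j : 'I_n) (ij : i != j).
Hypothesis ijP : forall k, k = i \/ k = j.

(** For [x = z + s z], [split_u] applies to [ad z (v j)], and adding the image under [s] leaves
    [ad (u i) y = c * v i]. Here [c] lies in [Sv] and commutes with [u i], hence is a combination of
    [1] and [v j]. *)
Lemma ad_Alt_v x : x \in Alt ->
  exists f d, ad x (v j) = f *: v i + d *: (v j * v i).
Proof.
move=> /AltP [z ->].
have [|y0 [y [y0S yS zE]]] := @split_u i (ad z (v j)).
  move=> k ki; have [ki'|->] := ijP k; first by rewrite ki' eqxx in ki.
  exact: ad_v_comm.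
have -> : ad (z + s z) (v j) = ad (u i) y.
  have szE : s (ad z (v j)) = ad (s z) (v j).
    by rewrite !adE sD !sM sv addrC.
  have -> : ad (z + s z) (v j) = ad z (v j) + s (ad z (v j)).
    rewrite szE !adE; nc2 charF.
  rewrite zE sD sM su !Sv_sym // adE; cancel2 charF.
pose c := ad (u i) y * (v i)^-1.
have cS : c \in Sv by rewrite SvM ?ad_u_Sv ?SvV.
have cu : c * u i = u i * c by exact: ad_u_div_comm.
have cE : ad (u i) y = c * v i by rewrite mulrVK ?v_unit.
have adcu : ad (u j) c * u i = u i * ad (u j) c by exact: cent_ad.
have /mem1vP [f fE] : c + ad (u j) c \in 1%VS.
  apply: mem_Svk0 => [|k]; first by rewrite rpredD ?ad_u_Sv.
  have [->|->] := ijP k; first by rewrite mulrDl mulrDr cu adcu.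
  by apply: (ad_eq0); rewrite linearD /= ad_u_idem addvv.
have /mem1vP [d dE] : ad (u j) c * (v j)^-1 \in 1%VS.
  apply: mem_Svk0 => [|k]; first by rewrite SvM ?ad_u_Sv ?SvV.
  have [->|->] := ijP k; last exact: ad_u_div_comm.
  by rewrite -mulrA -uVvC // mulrA adcu mulrA.
exists f, d; rewrite cE.
have -> : c = f%:A + d *: v j.
  rewrite -fE -[v j]mul1r scalerAl -dE mulrVK ?v_unit //.
  by rewrite -addrA addvv addr0.
by rewrite mulrDl -!scalerAl mul1r.
Qed.

(** [ad (u k)] kills the terms free of [v k] and fixes those containing it, which separates the
    coefficients. *)
Lemma v_indep a b c : a *: v i + b *: v j + c *: (v i * v j) = 0 ->
  [/\ a = 0, b = 0 & c = 0].
Proof.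
have indep (k : 'I_n) x y : x * u k = u k * x -> y * u k = u k * y ->
    x + y * v k = 0 -> x = 0 /\ y = 0.
  move=> xu yu xy0; have y0 : y = 0.
    apply: (mulIr (v_unit k)); rewrite mul0r.
    have <- : ad (u k) (x + y * v k) = y * v k.
      rewrite linearD /= (ad_comm (esym xu)) add0r adE mulrA -yu -!mulrA -mulrDr.
      by rewrite uv.
    by rewrite xy0 linear0.
  by move: xy0; rewrite y0 mul0r addr0.
have ji : j != i by rewrite eq_sym.
have scal_inj (d : F) : d%:A = 0 :> A -> d = 0.
  by move/eqP; rewrite scaler_eq0 oner_eq0 orbF => /eqP.
have indep_j (d e : F) : d%:A + e%:A * v j = 0 -> d = 0 /\ e = 0.
  have scalC (c' : F) y : c'%:A * y = y * c'%:A.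
    by rewrite -scalerAl -scalerAr mulr1 mul1r.
  by move/indep; case=> // /scal_inj -> /scal_inj ->.
have uC (d e : F) : (d%:A + e%:A * v j) * u i = u i * (d%:A + e%:A * v j).
  by rewrite -scalerAl mul1r mulrDl mulrDr -!scalerAl -!scalerAr mul1r mulr1 uvC.
move=> h; have [| | |h1 h2] := indep i (0%:A + b%:A * v j) (a%:A + c%:A * v j).
- exact: uC.
- exact: uC.
- rewrite scale0r add0r mulrDl -!scalerAl !mul1r (vvC j) -[RHS]h.
  cancel2 charF.
have [_ ->] := indep_j _ _ h1.
by have [-> ->] := indep_j _ _ h2.
Qed.
End TwoIndices.

Lemma Alt_ad_Sym x y : x \in Alt -> s y = y -> ad x y \in Alt.
Proof.
move=> /(subvP Alt_sub_Sym)/SymP sx sy.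
by apply/AltP; exists (x * y); rewrite adE sM sx sy.
Qed.

Lemma v_Alt i : v i \in Alt.
Proof. by apply/AltP; exists (u i * v i); rewrite sM su sv uv. Qed.

(** [ad x] is a derivation of square zero whose values at [v i] and [v j] involve four scalars.
    Comparing coefficients in its square at [v i] and [v j] makes all four vanish. *)
Lemma Alt_sqr_Sv2 (i j : 'I_n) x : i != j -> (forall k, k = i \/ k = j) ->
  x \in Alt -> x * x \in 1%VS -> x \in Sv.
Proof.
move=> ij ijP xA xx; have ji : j != i by rewrite eq_sym.
have jiP k : k = j \/ k = i by case: (ijP k); auto.
have [f1 [d xi]] := ad_Alt_v ji jiP xA.
have [f2 [b]] := ad_Alt_v ij ijP xA; rewrite (vvC j i) => xj.
have [bi bi0 vi2] := vv i; have [bj bj0 vj2] := vv j.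
have xij : ad x (v i * v j) =
    (f1 * bj + f2 * bi)%:A + (d * bj) *: v i + (b * bi) *: v j.
  rewrite (ad_derivation charF) xi xj mulrDl mulrDr -!scalerAl -!scalerAr.
  rewrite !mulrA -(mulrA (v i)) vj2 vi2 -scalerAl -scalerAr mulr1 mul1r.
  rewrite !scalerA scalerDl; cancel2 charF.
(* This scalar is a sum of alternating elements. *)
have fb : f1 * bj + f2 * bi = 0.
  suff /(Alt_scalar) h : (f1 * bj + f2 * bi)%:A \in Alt.
    have /eqP := h (introT (mem1vP _) (ex_intro _ _ erefl)).
    by rewrite scaler_eq0 oner_eq0 orbF => /eqP.
  have -> : (f1 * bj + f2 * bi)%:A =
      ad x (v i * v j) + (d * bj) *: v i + (b * bi) *: v j.
    by rewrite xij; cancel2 charF.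
  rewrite !rpredD ?rpredZ ?v_Alt //; apply: Alt_ad_Sym => //.
  by rewrite sM !sv vvC.
have xx_i := ad_idem_sqr charF (v i) xx; have xx_j := ad_idem_sqr charF (v j) xx.
move: xij; rewrite fb scale0r add0r => xij.
have [|e1 e2 e3] := @v_indep i j ij (f1 * f2 + d * (d * bj)) (d * (b * bi)) (f1 * b).
  rewrite -{}xx_i xi linearD !linearZ /= xj xij !scalerDr !scalerA scalerDl.
  cancel2 charF.
have [|e4 e5 e6] := @v_indep i j ij (b * (d * bj)) (f2 * f1 + b * (b * bi)) (f2 * d).
  rewrite -{}xx_j xj linearD !linearZ /= xi xij !scalerDr !scalerA scalerDl.
  cancel2 charF.
have b0 : b = 0.
  apply/eqP/negPn/negP => b0; move: e5.
  have /eqP := e3; rewrite mulf_eq0 (negPf b0) orbF => /eqP ->.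
  by rewrite mulr0 add0r => /eqP; rewrite !mulf_eq0 (negPf b0) (negPf bi0).
have d0 : d = 0.
  apply/eqP/negPn/negP => d0; move: e1.
  have /eqP := e6; rewrite mulf_eq0 (negPf d0) orbF => /eqP ->.
  by rewrite mulr0 add0r => /eqP; rewrite !mulf_eq0 (negPf d0) (negPf bj0).
have {e1} /eqP : f1 * f2 = 0 by rewrite -e1 d0 mul0r addr0.
rewrite mulf_eq0 => f12.
have [f10 f20] : f1 = 0 /\ f2 = 0.
  case/orP: f12 => /eqP f0; move/eqP: fb;
    rewrite f0 mul0r ?add0r ?addr0 mulf_eq0 ?(negPf bi0) ?(negPf bj0) orbF.
    by move=> /eqP.
  by move=> /eqP.
apply/SvP => k; apply/esym/ad_eq0.
by have [->|->] := ijP k; rewrite ?xi ?xj ?f10 ?f20 ?b0 ?d0 !scale0r addr0.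
Qed.

Lemma Alt_sqr_Sv x : (n <= 2)%N -> x \in Alt -> x * x \in 1%VS -> x \in Sv.
Proof.
move=> n2 xA xx; have : n = 0%N \/ n = 1%N \/ n = 2%N by lia.
case=> [n0|[n1|n2']].
- by apply/SvP => k; exfalso; have := ltn_ord k; lia.
(* With a single index, [ad z (v i)] lies in [Sv], so it is symmetric and cancels against its image
   under [s]. *)
- apply/SvP => i; have iP k : k = i by apply: val_inj; case: k i => [k ?] [l ?] /=; lia.
  apply/esym/ad_eq0; case/AltP: xA => z ->.
  have /Sv_sym : ad z (v i) \in Sv by apply/SvP => k; rewrite (iP k) ad_v_comm.
  rewrite s_ad sv => zE; have := addvv (ad z (v i)).
  by rewrite -{2}zE !adE => <-; nc2 charF.
have [n_gt0 n_gt1] : (0 < n)%N /\ (1 < n)%N by rewrite n2'.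
apply: (@Alt_sqr_Sv2 (Ordinal n_gt0) (Ordinal n_gt1)) => // -[k kn].
by case: k kn => [|[|k]] kn; [left|right|lia]; apply: val_inj.
Qed.

Lemma small_insep_unique T :
  (n <= 2)%N -> inseparable_subalg s T -> Sv = T.
Proof.
move=> n2 Tins; apply: insep_sub_eq => //; apply/subvP => x xT.
have /memv_addP [_ /mem1vP [c ->] [t tA xE]] := subvP (insep_sub_Alt Tins) x xT.
rewrite xE rpredD ?rpredZ ?Sv1 // Alt_sqr_Sv //.
have -> : t * t = x * x + (c * c)%:A.
  rewrite xE !mulrDl !mulrDr -!scalerAl -!scalerAr !mulr1 !mul1r scalerA.
  cancel2 charF.
case: Tins => m [_ _ Tsym _ _]; have [_ xx] := Tsym x xT.
by rewrite rpredD // rpredZ // memv_line.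
Qed.

(** * Nonuniqueness in degree at least eight *)

Lemma insep_conj m T : m * m = 0 -> s m = m -> inseparable_subalg s T ->
  inseparable_subalg s ((amulr (1 + m) \o amull (1 + m)) @: T)%VS.
Proof.
(* In characteristic two [g] is its own inverse and symmetric, so conjugation by [g] is an
   automorphism commuting with [s]. *)
set g := 1 + m => mm sm; set cg := (_ \o _)%VF.
have cgE x : cg x = g * x * g by rewrite comp_lfunE !lfunE.
have gg : g * g = 1.
  by rewrite /g mulrDl !mulrDr mm !mulr1 mul1r addr0 -addrA addvv addr0.
have sg : s g = g by rewrite /g sD s1 sm.
have cgK x : cg (cg x) = x.
  by rewrite !cgE !mulrA gg mul1r -mulrA gg mulr1.
have cgM x y : cg (x * y) = cg x * cg y.
  by rewrite !cgE -!mulrA (mulrA g g) gg mul1r.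
have cg1 : cg 1 = 1 by rewrite cgE mulr1.
have mem_cg x U : (x \in cg @: U)%VS = (cg x \in U).
  apply/memv_imgP/idP => [[y yU ->]|xU]; first by rewrite cgK.
  by exists (cg x); rewrite ?cgK.
have cgZ (c : F) : cg c%:A = c%:A by rewrite linearZ /= cg1.
case=> k [dk [[T1 /prodvP TM] dT] Tsym CT [xs [sxs genT]]]; exists k; split=> //.
- split; last first.
    rewrite limg_dim_eq //; apply/eqP; rewrite -subv0; apply/subvP => x.
    rewrite memv_cap memv_ker memv0 => /andP [_ /eqP cgx0].
    by rewrite -[x]cgK cgx0 linear0.
  split; first by rewrite mem_cg cg1.
  by apply/prodvP => x y; rewrite !mem_cg cgM; exact: TM.
- move=> x; rewrite mem_cg => xT; have [sx xx] := Tsym _ xT; split.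
    by rewrite -[x]cgK [in LHS]cgE !sM sg sx mulrA -cgE.
  case/mem1vP: xx => c xx; apply/mem1vP; exists c.
  by rewrite -[x]cgK -cgM xx cgZ.
- apply/vspaceP => x; rewrite mem_cg -[in RHS]CT.
  apply/centvP/centvP => h y yT; apply: (can_inj cgK); rewrite !cgM ?cgK.
    by apply: h; rewrite mem_cg cgK.
  by apply: h; rewrite -mem_cg.
exists (map cg xs); rewrite size_map; split=> //.
apply/eqP; rewrite eqEsubv; apply/andP; split.
  apply: agenv_min => [|x y|_ /mapP [x xs_x ->]]; first by rewrite mem_cg cg1.
    by rewrite !mem_cg cgM; exact: TM.
  rewrite mem_cg cgK -genT; apply: (subvP (sub_agenv _)); exact: memv_span.
apply/subvP => x; rewrite mem_cg => xT; rewrite -[x]cgK -mem_cg; move: xT.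
move: (cg x) => {}x; move: x; apply/subvP; rewrite -genT.
apply: agenv_min => [|x y|x xs_x].
- by rewrite mem_cg cg1 (subvP (sub1_agenv _)) // memv_line.
- by rewrite !mem_cg cgM; exact: (memvM (A := agenv_aspace _)).
by rewrite mem_cg (subvP (sub_agenv _)) // memv_span // map_f.
Qed.

(** Degree at least eight enters here: the second subalgebra is built from three distinct
    indices. *)
Lemma two_other_indices (i : 'I_n) : (2 < n)%N ->
  exists j l : 'I_n, [/\ j != i, l != i & j != l].
Proof.
move=> n3; have [n0 n1] : (0 < n)%N /\ (1 < n)%N by lia.
have [i0|i0] := eqVneq (val i) 0%N.
  by exists (Ordinal n1), (Ordinal n3); rewrite -!val_eqE /= i0.
have [i1|i1] := eqVneq (val i) 1%N.
  by exists (Ordinal n0), (Ordinal n3); rewrite -!val_eqE /= i1.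
by exists (Ordinal n0), (Ordinal n1); rewrite -!val_eqE /= !(eq_sym _ (val i)) i0.
Qed.

(* For a nilpotent [x] in the first [Svk i.+1] containing one, [ad (u i) x] is
   invertible; conjugation by the isometry [1 + x (u j) (u l) (u i) x] then
   moves [v j] out of [Sv]. *)
Lemma unique_nil_free : (2 < n)%N ->
    (forall T, inseparable_subalg s T -> Sv = T) ->
  forall x, x \in Sv -> x * x = 0 -> x = 0.
Proof.
move=> n3 uniqT; rewrite -Svk_last; suff: forall k, (k <= n)%N ->
  forall x, x \in Svk k -> x * x = 0 -> x = 0 by apply.
elim=> [_ x|k IH kn x].
  rewrite Svk0 => /mem1vP [c ->]; rewrite -scalerAl mul1r scalerA => /eqP.
  by rewrite scaler_eq0 oner_eq0 orbF mulf_eq0 orbb => /eqP ->; rewrite scale0r.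
pose i := Ordinal kn => xk xx; have {}IH := IH (ltnW kn).
have [x0 [b [x0k bk uxE xE]]] := @Svk_split i x xk.
have xS : x \in Sv by apply: (subvP (capvSl _ _) _ xk).
have bS : b \in Sv by apply: (subvP (capvSl _ _) _ bk).
have [b0|b0] := eqVneq b 0.
  by apply: IH xx; rewrite xE b0 mul0r addr0.
(* [b * b] is a scalar, nonzero since [Svk i] contains no nonzero element of square zero. *)
have b_unit : b \is a GRing.unit.
  have /mem1vP [c bb] := Sv_sqr bS; apply: (scalar_unit (c := c)) => //.
  apply: contraNneq b0 => c0; apply/eqP/IH => //.
  by rewrite bb c0 scale0r.
have [j [l [ji li jl]]] := two_other_indices i n3.
pose z := u j * u l * u i; pose m := x * z * x.
have sz : s z = z.
  by rewrite !sM !su (uuC l) mulrA (uuC i) -mulrA (uuC i) mulrA.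
have sx := Sv_sym xS.
have sm : s m = m by rewrite /m sM (sM x) sx sz mulrA.
have mm : m * m = 0 by rewrite /m -!mulrA (mulrA x x) xx mul0r !mulr0.
have vx k' : v k' * x = x * v k' by rewrite (SvP _ xS).
have mvm k' : m * v k' * m = 0.
  by rewrite /m -!mulrA (mulrA x (v k')) -vx -(mulrA (v k')) (mulrA x x) xx mul0r !mulr0.
have SvE := uniqT _ (insep_conj mm sm Sv_insep).
have : (1 + m) * v j * (1 + m) \in Sv.
  by rewrite SvE; apply/memv_imgP; exists (v j); rewrite ?v_in_Sv // comp_lfunE !lfunE.
(* As [m * v j * m = 0], the conjugate of [v j] is [v j + ad (v j) m]. *)
rewrite !mulrDl !mulrDr mul1r !mulr1 mvm addr0 => cS.
have {cS} : ad (v j) m \in Sv.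
  have -> : ad (v j) m = v j + (v j + v j * m + m * v j).
    by rewrite adE; cancel2 charF.
  by rewrite rpredD ?v_in_Sv // addrA.
have xad y k' : ad (v k') (x * y * x) = x * ad (v k') y * x.
  by rewrite !adE mulrDr mulrDl !mulrA vx -!mulrA -vx.
have adu k' : ad (v k') (u k') = v k' by rewrite adE addrC uv.
have adu0 k' k'' : k'' != k' -> ad (v k') (u k'') = 0.
  by move=> kk; rewrite ad_comm // uvC.
(* [ad (v j)] passes through the outer factors [x] and turns [u j] into [v j]. The result lies in
   [Sv], so [ad (v l)], which turns [u l] into [v l], kills it. *)
rewrite xad !(ad_derivation charF) adu !adu0 // 1?eq_sym // !mulr0 !addr0.
move=> /SvP /(_ l) vlC.
have : ad (v l) (x * (v j * u l * u i) * x) = 0.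
  by apply: ad_comm.
rewrite xad !(ad_derivation charF) adu !adu0 1?eq_sym // (ad_comm (vvC l j)).
rewrite !mulr0 addr0 mul0r add0r.
(* Since [x * x = 0], [x * u i * x = x * ad (u i) x]. The vanishing product becomes a unit times
   [x]. *)
have -> : x * (v j * v l * u i) * x = v j * v l * b * v i * x.
  have xux : x * u i * x = x * (b * v i).
    by rewrite -uxE adE mulrDr (mulrA x x) xx mul0r addr0 mulrA.
  have xv : x * (v j * v l) = v j * v l * x by rewrite SvC // SvM ?v_in_Sv.
  by rewrite (mulrA x) xv -!(mulrA (v j * v l)) xux (SvC xS) ?SvM ?v_in_Sv.
move=> h.
have un : v j * v l * b * v i \is a GRing.unit by rewrite !unitrMl ?v_unit.
by apply: (mulrI un); rewrite h mulr0.
Qed.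

End Frame.
End Involution.

(** * The characterization of uniqueness *)

Theorem theorem3p10 (F : fieldType) (A : falgType F) (sigma : A -> A) :
  (2 \in [pchar F])%N ->
  central_simple A ->
  orthogonal_char2 sigma ->
  totally_decomposable sigma ->
  ((exists! S : {vspace A}, inseparable_subalg sigma S) <->
   ((\dim (fullv : {vspace A}) <= 16)%N \/ anisotropic sigma)).
Proof.
move=> charF _ [[s_lin sM sK] s_orth] [n [Q [Qquat sQ QC dimA]]].
(* As a linear endomorphism, the involution has an image and a kernel that are subspaces. *)
have [s sE] : exists s : 'End(A), sigma =1 s.
  pose L := GRing.isLinear.Build F A A _ sigma s_lin.
  pose f : {linear A -> A} := HB.pack sigma L.
  by exists (linfun f) => x; rewrite lfunE.
have {}sM x y : s (x * y) = s y * s x by rewrite -!sE.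
have {}sK x : s (s x) = x by rewrite -!sE.
have {}s_orth x : x + s x != 1.
  by apply/eqP => h; apply: s_orth; exists x; rewrite sE.
have {}sQ i x : x \in Q i -> s x \in Q i by rewrite -sE; exact: sQ.
have insepE T : inseparable_subalg sigma T <-> inseparable_subalg s T.
  by split=> -[m [? ? Tsym ? ?]]; exists m; split=> // x /Tsym [];
    split; rewrite // ?sE // -sE.
have anisoE : anisotropic sigma <-> anisotropic s.
  by split=> h [x [x0 sxx]]; apply: h; exists x; rewrite ?sE // -sE.
have gens i := quat_gens charF sM sK s_orth (Qquat i) (sQ i).
have [u /fin_all_exists [v uvP]] := fin_all_exists gens.
have uQ i : u i \in Q i by have [[]] := uvP i.
have vQ i : v i \in Q i by have [[]] := uvP i.
have su i : s (u i) = u i by have [_ []] := uvP i.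
have sv i : s (v i) = v i by have [_ []] := uvP i.
have uv i : u i * v i + v i * u i = v i by have [] := uvP i.
have uu i : exists a, u i * u i = u i + a%:A by have [] := uvP i.
have vv i : exists2 b, b != 0 & v i * v i = b%:A by have [] := uvP i.
have uuC i j : u i * u j = u j * u i.
  by have [->//|ij] := eqVneq i j; apply: QC ij _ _.
have vvC i j : v i * v j = v j * v i.
  by have [->//|ij] := eqVneq i j; apply: QC ij _ _.
have uvC i j : i != j -> u i * v j = v j * u i by move=> ij; apply: QC ij _ _.
have nil_free := unique_nil_free charF sM sK su sv uv uu vv uuC vvC uvC dimA.
have Sins := Sv_insep charF sM sK sv uv uu vv uuC vvC uvC dimA.
split=> [[S [_ uniqS]]|h].
  (* The degree is [2 ^ n], so the dimension bound [16 = 4 ^ 2] means [n <= 2]. *)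
  have [n2|n3] := leqP n 2; [left|right].
    by rewrite dimA (@leq_pexp2l 4 n 2).
  apply/anisoE/(nil_free_anisotropic charF sM sK s_orth sv uv uu vv uuC vvC uvC dimA).
  apply: nil_free => // T Tins.
  by rewrite -(uniqS T) ?insepE // (uniqS (Sv v)) ?insepE.
exists (Sv v); split=> [|T /insepE Tins]; first exact/insepE.
case: h => [|/anisoE aniso].
  rewrite dimA -[16%N]/(4 ^ 2)%N leq_exp2l // => n2.
  exact (small_insep_unique charF sM sK s_orth su sv uv uu vv uuC vvC uvC dimA n2 Tins).
exact (anisotropic_insep_unique charF sM sK s_orth sv uv uu vv uuC vvC uvC dimA aniso Tins).
Qed.
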